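(* Let $m,n\ge 1$ and let $A=[A_{i,j}]_{i,j=1}^m\in \mathbb{M}_m(\mathbb{M}_n)$ be positive semidefinite. Then \[ (\mathrm{tr}\, A)I_{nm} - (\mathrm{tr}_1 A)\otimes I_m \ \ge\ \pm\bigl( I_n\otimes (\mathrm{tr}_2 A) - \widetilde{A}\bigr) \] (for each choice of sign), and \[ (\mathrm{tr}\, A)I_{nm} + (\mathrm{tr}_1 A)\otimes I_m \ \ge\ I_n\otimes (\mathrm{tr}_2 A) + \widetilde{A}. \]
   Context: $\mathbb{M}_n$ is the set of $n\times n$ complex matrices, $I_n$ is the identity matrix of order $n$. $\mathbb{M}_m(\mathbb{M}_n)$ is the set of complex $mn\times mn$ matrices partitioned into $m\times m$ blocks, each block in $\mathbb{M}_n$; an element is written $A=[A_{i,j}]_{i,j=1}^m$ with $A_{i,j}\in\mathbb{M}_n$. For Hermitian matrices $X,Y$ of the same order, $X\ge Y$ means $X-Y$ is positive semidefinite. The tensor (Kronecker) product of $X=[x_{ij}]$ and $Y$ is the block matrix $X\otimes Y$ whose $(i,j)$-block is $x_{ij}Y$. The partial traces of $A=[A_{i,j}]_{i,j=1}^m\in\mathbb{M}_m(\mathbb{M}_n)$ are $\mathrm{tr}_1 A=\sum_{i=1}^m A_{i,i}\in\mathbb{M}_n$ and $\mathrm{tr}_2 A=[\mathrm{tr}\,A_{i,j}]_{i,j=1}^m\in\mathbb{M}_m$, where $\mathrm{tr}$ is the ordinary trace. Writing $A_{i,j}=[a^{i,j}_{r,s}]_{r,s=1}^n$, the matrix $\widetilde{A}\in\mathbb{M}_n(\mathbb{M}_m)$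 is defined by $\widetilde{A}=[B_{r,s}]_{r,s=1}^n$, where $B_{r,s}=[a^{i,j}_{r,s}]_{i,j=1}^m\in\mathbb{M}_m$. *)

(* Defs.v *)
From mathcomp Require Import all_boot all_order all_algebra.
From mathcomp Require Import sesquilinear spectral.
From mathcomp Require Export mxtens complex reals.

Set Implicit Arguments.
Unset Strict Implicit.
Unset Printing Implicit Defensive.

Import Order.TTheory GRing.Theory Num.Theory.
Local Open Scope ring_scope.
Local Open Scope sesquilinear_scope.

(* In a [numClosedFieldType], [0 <= z] means that z is real and nonnegative. *)
Definition psdmx (C : numClosedFieldType) (n : nat) (A : 'M[C]_n) : Prop :=
  A \is hermsymmx /\ forall x : 'cV[C]_n, 0 <= (x ^t* *m A *m x) 0 0.

Definition loewner_le (C : numClosedFieldType) (n : nat) (X Y : 'M[C]_n) : Prop :=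
  [/\ X \is hermsymmx, Y \is hermsymmx & psdmx (Y - X)].

Notation "X <=L Y" := (loewner_le X Y) (at level 70, no associativity).

(* An element of M_m(M_n) is a matrix of order m * n whose index
   [mxtens_index (i, r)], i.e. i * n + r, is position r of block i. *)
Section Blocks.
Context {R : pzRingType} {m n : nat}.

Definition blk (A : 'M[R]_(m * n)) (i j : 'I_m) : 'M[R]_n :=
  \matrix_(r, s) A (mxtens_index (i, r)) (mxtens_index (j, s)).

Definition of_blks (B : 'I_m -> 'I_m -> 'M[R]_n) : 'M[R]_(m * n) :=
  \matrix_(k, l) B (mxtens_unindex k).1 (mxtens_unindex l).1
                   (mxtens_unindex k).2 (mxtens_unindex l).2.

Lemma blk_of_blks B i j : blk (of_blks B) i j = B i j.
Proof. by apply/matrixP => r s; rewrite !mxE !mxtens_indexK. Qed.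

Lemma of_blksK A : of_blks (blk A) = A.
Proof. by apply/matrixP => k l; rewrite !mxE -!surjective_pairing !mxtens_unindexK. Qed.

Lemma blk_tensmx (X : 'M[R]_m) (Y : 'M[R]_n) i j :
  blk (tensmx X Y) i j = X i j *: Y.
Proof. by apply/matrixP => r s; rewrite mxE tensmxE !mxE. Qed.

Definition ptrace1 (A : 'M[R]_(m * n)) : 'M[R]_n := \sum_(i < m) blk A i i.

Definition ptrace2 (A : 'M[R]_(m * n)) : 'M[R]_m :=
  \matrix_(i, j) \tr (blk A i j).

End Blocks.

Definition tildemx {R : pzRingType} {m n : nat} (A : 'M[R]_(m * n)) :
    'M[R]_(n * m) :=
  of_blks (fun r s : 'I_n => \matrix_(i < m, j < m) blk A i j r s).

(* Main.v *)
Require Import Defs.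
From mathcomp Require Import all_boot all_order all_algebra.
From mathcomp Require Import sesquilinear spectral ring.

Set Implicit Arguments.
Unset Strict Implicit.
Unset Printing Implicit Defensive.

Import Order.TTheory GRing.Theory Num.Theory.
Local Open Scope ring_scope.
Local Open Scope sesquilinear_scope.

(** The idea is a factorization in the group algebra of the Klein four-group.
    Take first [A] of rank one, with entries [V i r * (V j s)^*], and a test
    vector [x] whose entry at position [i] of block [r] is [X i r].  Consider
    the tensor [T i r j s = X i r * V j s], let [P] be the operator exchanging
    the row indices [i] and [j], and [Q] the one exchanging the column indices
    [r] and [s].  Then the values at [x] of the Hermitian forms of
    [(\tr A) I], [tr_1 A (x) I], [I (x) tr_2 A] and [tildemx A] are
    respectively [<T, T>], [<T, Q T>], [<T, P T>] and [<T, P Q T>].  Hence, for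
    signs [a] and [b], the form of
    [(\tr A) I + b (tr_1 A (x) I) + a (I (x) tr_2 A) + a b (tildemx A)]
    is [<T, (1 + a P) (1 + b Q) T>].  As [P] and [Q] are commuting Hermitian
    involutions, this is a quarter of the squared norm of
    [(1 + a P) (1 + b Q) T], so it is nonnegative.  The three inequalities are
    the sign choices [(a, b) = (-1, -1), (1, -1), (-1, 1)].

    For a general [A], the role of the entry of [T] at [w] is played by the
    vector [tensor_col x w], and that of the product of one entry by the
    conjugate of another by the form of [A] at two such vectors; the squared
    norm becomes a sum of values of the form of [A], each of them nonnegative by
    hypothesis.  The factorization is two applications of
    [sum_sesq_symmetrize], and the four dictionary entries are
    [sesq_scalar_trace], [sesq_ptrace1], [sesq_ptrace2] and [sesq_tildemx];
    they combine into [sesq_signed_ptraces_ge0]. *)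

(** * Sesquilinear forms and symmetrization *)

Section ComplexMatrices.
Context {C : numClosedFieldType}.

Definition sesq N (M : 'M[C]_N) (x y : 'cV[C]_N) : C := (x ^t* *m M *m y) 0 0.

Lemma sesqE N (M : 'M[C]_N) x y :
  sesq M x y = \sum_k \sum_l (x k 0)^* * M k l * y l 0.
Proof.
rewrite /sesq mxE exchange_big /=; apply: eq_bigr => l _.
rewrite mxE mulr_suml; apply: eq_bigr => k _.
by rewrite !mxE.
Qed.

Lemma sesqDl N (M : 'M[C]_N) x1 x2 y :
  sesq M (x1 + x2) y = sesq M x1 y + sesq M x2 y.
Proof. by rewrite /sesq linearD map_mxD !mulmxDl mxE. Qed.

Lemma sesqDr N (M : 'M[C]_N) x y1 y2 :
  sesq M x (y1 + y2) = sesq M x y1 + sesq M x y2.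
Proof. by rewrite /sesq mulmxDr mxE. Qed.

Lemma sesqZl N (M : 'M[C]_N) c x y : sesq M (c *: x) y = c^* * sesq M x y.
Proof. by rewrite /sesq linearZ map_mxZ -!scalemxAl mxE. Qed.

Lemma sesqZr N (M : 'M[C]_N) c x y : sesq M x (c *: y) = c * sesq M x y.
Proof. by rewrite /sesq -scalemxAr mxE. Qed.

Lemma sesqMD N (M1 M2 : 'M[C]_N) x y :
  sesq (M1 + M2) x y = sesq M1 x y + sesq M2 x y.
Proof. by rewrite /sesq mulmxDr mulmxDl mxE. Qed.

Lemma sesqMZ N c (M : 'M[C]_N) x y : sesq (c *: M) x y = c * sesq M x y.
Proof. by rewrite /sesq -scalemxAr -scalemxAl mxE. Qed.

Lemma sesq_delta N (M : 'M[C]_N) k l :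
  sesq M (delta_mx k 0) (delta_mx l 0) = M k l.
Proof. by rewrite /sesq trmx_delta map_delta_mx -rowE -colE !mxE. Qed.

(** Reindexing by the involution [s] turns the two terms of the expansion in
    which [u (s w)] comes first into the two others: this is the identity
    [(1 + e S)^2 = 2 (1 + e S)] for an involution [S] and a sign [e].  The map
    [f], commuting with [s], allows the lemma to be applied again to the terms
    that an earlier application produces. *)
Lemma sum_sesq_symmetrize N (M : 'M[C]_N) (W : finType) (s f : W -> W)
    (u : W -> 'cV[C]_N) (b : bool) :
    involutive s -> (forall w, f (s w) = s (f w)) ->
  \sum_w sesq M (u w + (-1) ^+ b *: u (s w)) (u (f w) + (-1) ^+ b *: u (s (f w)))
  = (\sum_w sesq M (u w) (u (f w))
     + (-1) ^+ b * \sum_w sesq M (u w) (u (s (f w)))) *+ 2.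
Proof.
move=> sK sf.
have refl (F : W -> C) : \sum_w F (s w) = \sum_w F w.
  by rewrite [RHS](reindex_inj (inv_inj sK)).
pose A w := sesq M (u w) (u (f w)); pose B w := sesq M (u w) (u (s (f w))).
rewrite (eq_bigr (fun w => (A w + A (s w)) + (-1) ^+ b * (B w + B (s w)))).
  by rewrite big_split -mulr_sumr !big_split /= !refl /A /B; ring.
move=> w _; rewrite /A /B !sf sK !(sesqDl, sesqDr, sesqZl, sesqZr) rmorph_sign.
by rewrite mulrA -expr2 sqrr_sign; ring.
Qed.

(** * Exchanging the indices of a product of two matrices *)

(** The pair [((i, r), (j, s))] indexes the products [X i r * V j s]. *)
Definition swap_rows {m n} (w : ('I_m * 'I_n) * ('I_m * 'I_n)) :=
  ((w.2.1, w.1.2), (w.1.1, w.2.2)).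

Definition swap_cols {m n} (w : ('I_m * 'I_n) * ('I_m * 'I_n)) :=
  ((w.1.1, w.2.2), (w.2.1, w.1.2)).

Lemma swap_rowsK m n : involutive (@swap_rows m n).
Proof. by case=> [[i r] [j s]]. Qed.

Lemma swap_colsK m n : involutive (@swap_cols m n).
Proof. by case=> [[i r] [j s]]. Qed.

Lemma sum_mxtens p q (F : 'I_(p * q) -> C) :
  \sum_k F k = \sum_i \sum_j F (mxtens_index (i, j)).
Proof.
rewrite pair_bigA (reindex (@mxtens_index p q)) /=.
  by apply: eq_bigr => -[].
by exists (@mxtens_unindex p q) => ? _; rewrite (mxtens_indexK, mxtens_unindexK).
Qed.

Lemma sum_delta (I : finType) (i : I) (F : I -> C) :
  \sum_j (i == j)%:R * F j = F i.
Proof.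
rewrite (bigD1 i) //= eqxx mul1r big1 ?addr0 // => j /negPf.
by rewrite eq_sym => ->; rewrite mul0r.
Qed.

(** * The four quadratic forms as sums over index pairs *)

Section Forms.
Context {m n : nat} (A : 'M[C]_(m * n)) (x : 'cV[C]_(n * m)).

(** If [A i j = v i * (v j)^*], then [v^*] applied to [tensor_col w] is the
    conjugate of [T w = X i r * v (j, s)], where [w = ((i, r), (j, s))] and
    [X i r] is the entry of [x] at position [i] of block [r].  The
    form of [A] at [tensor_col w] and [tensor_col w'] is then
    [T w * (T w')^*]. *)
Definition tensor_col (w : ('I_m * 'I_n) * ('I_m * 'I_n)) : 'cV[C]_(m * n) :=
  (x (mxtens_index (w.1.2, w.1.1)) 0)^* *: delta_mx (mxtens_index w.2) 0.

Lemma sesq_tensor_col w w' :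
  sesq A (tensor_col w) (tensor_col w')
  = (x (mxtens_index (w'.1.2, w'.1.1)) 0)^*
    * A (mxtens_index w.2) (mxtens_index w'.2)
    * x (mxtens_index (w.1.2, w.1.1)) 0.
Proof. by rewrite sesqZl sesqZr sesq_delta conjCK; ring. Qed.

Lemma sum_indices (F : ('I_m * 'I_n) * ('I_m * 'I_n) -> C) :
  \sum_w F w = \sum_i \sum_r \sum_j \sum_s F ((i, r), (j, s)).
Proof.
transitivity (\sum_w F ((w.1.1, w.1.2), (w.2.1, w.2.2))).
  by apply: eq_bigr => -[[? ?] [? ?]].
rewrite -(pair_bigA _ (fun p q => F ((p.1, p.2), (q.1, q.2)))).
rewrite -(pair_bigA _ (fun i r => \sum_q F ((i, r), (q.1, q.2)))).
apply: eq_bigr => i _; apply: eq_bigr => r _.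
by rewrite -(pair_bigA _ (fun j s => F ((i, r), (j, s)))).
Qed.

Lemma sesq_scalar_trace :
  \sum_w sesq A (tensor_col w) (tensor_col w) = sesq (\tr A)%:M x x.
Proof.
rewrite sum_indices sesqE [RHS]exchange_big sum_mxtens exchange_big.
apply: eq_bigr => r _; apply: eq_bigr => i _.
set k := mxtens_index (r, i).
have -> : \sum_l (x l 0)^* * (\tr A)%:M l k * x k 0
          = (x k 0)^* * \tr A * x k 0.
  rewrite -[RHS](sum_delta k (fun l => (x l 0)^* * \tr A * x k 0)).
  by apply: eq_bigr => l _; rewrite mxE eq_sym -mulr_natl; ring.
rewrite /mxtrace sum_mxtens mulr_sumr mulr_suml.
apply: eq_bigr => j _; rewrite mulr_sumr mulr_suml; apply: eq_bigr => s _.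
by rewrite sesq_tensor_col.
Qed.

Lemma sesq_tensmx1 (Y : 'M[C]_n) :
  sesq (tensmx Y 1%:M) x x
  = \sum_i \sum_s \sum_r (x (mxtens_index (s, i)) 0)^* * Y s r
                         * x (mxtens_index (r, i)) 0.
Proof.
rewrite sesqE sum_mxtens exchange_big; apply: eq_bigr => i _.
apply: eq_bigr => s _; rewrite sum_mxtens; apply: eq_bigr => r _.
rewrite -[RHS](sum_delta i (fun j => (x (mxtens_index (s, i)) 0)^* * Y s r
                                     * x (mxtens_index (r, j)) 0)).
by apply: eq_bigr => j _; rewrite tensmxE mxE; ring.
Qed.

Lemma sesq_1tensmx (Y : 'M[C]_m) :
  sesq (tensmx 1%:M Y) x x
  = \sum_r \sum_i \sum_j (x (mxtens_index (r, i)) 0)^* * Y i j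
                         * x (mxtens_index (r, j)) 0.
Proof.
rewrite sesqE sum_mxtens; apply: eq_bigr => r _; apply: eq_bigr => i _.
rewrite sum_mxtens exchange_big; apply: eq_bigr => j _.
rewrite -[RHS](sum_delta r (fun s => (x (mxtens_index (r, i)) 0)^* * Y i j
                                     * x (mxtens_index (s, j)) 0)).
by apply: eq_bigr => s _; rewrite tensmxE mxE; ring.
Qed.

Lemma sesq_ptrace1 :
  \sum_w sesq A (tensor_col w) (tensor_col (swap_cols w))
  = sesq (tensmx (ptrace1 A) 1%:M) x x.
Proof.
rewrite sum_indices sesq_tensmx1; apply: eq_bigr => i _.
rewrite [RHS]exchange_big; apply: eq_bigr => r _.
rewrite exchange_big; apply: eq_bigr => s _.
rewrite /ptrace1 summxE mulr_sumr mulr_suml; apply: eq_bigr => j _.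
by rewrite sesq_tensor_col mxE.
Qed.

Lemma sesq_ptrace2 :
  \sum_w sesq A (tensor_col w) (tensor_col (swap_rows w))
  = sesq (tensmx 1%:M (ptrace2 A)) x x.
Proof.
rewrite sum_indices sesq_1tensmx exchange_big; apply: eq_bigr => r _.
rewrite [RHS]exchange_big; apply: eq_bigr => i _; apply: eq_bigr => j _.
rewrite /ptrace2 mxE /mxtrace mulr_sumr mulr_suml; apply: eq_bigr => s _.
by rewrite sesq_tensor_col mxE.
Qed.

Lemma sesq_tildemx :
  \sum_w sesq A (tensor_col w) (tensor_col (swap_rows (swap_cols w)))
  = sesq (tildemx A) x x.
Proof.
rewrite sum_indices sesqE exchange_big [RHS]exchange_big sum_mxtens.
apply: eq_bigr => r _; apply: eq_bigr => i _.
rewrite sum_mxtens [RHS]exchange_big; apply: eq_bigr => j _; apply: eq_bigr => s _.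
by rewrite sesq_tensor_col !mxE !mxtens_indexK.
Qed.

(** Four times the form is the sum over [w] of the values of the form of [A] at
    the vectors obtained from [tensor_col w] by the two signed
    symmetrizations, one in the rows and one in the columns. *)
Lemma sesq_signed_ptraces_ge0 (a b : bool) : psdmx A ->
  0 <= sesq ((\tr A)%:M + (-1) ^+ b *: tensmx (ptrace1 A) 1%:M
             + (-1) ^+ a *: (tensmx 1%:M (ptrace2 A)
                             + (-1) ^+ b *: tildemx A)) x x.
Proof.
case=> _ A_ge0; rewrite !(sesqMD, sesqMZ).
rewrite -sesq_scalar_trace -sesq_ptrace1 -sesq_ptrace2 -sesq_tildemx.
pose t w := tensor_col w + (-1) ^+ b *: tensor_col (swap_cols w).
have : 0 <= \sum_w sesq A (t w + (-1) ^+ a *: t (swap_rows w))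
                          (t w + (-1) ^+ a *: t (swap_rows w)).
  by apply: sumr_ge0 => w _; apply: A_ge0.
(* The symmetrization in the rows leaves the terms [t w, t w] and
   [t w, t (swap_rows w)]; the one in the columns is then resolved in each,
   with [f] the identity and [swap_rows] respectively. *)
rewrite (sum_sesq_symmetrize A t a (@swap_rowsK m n) (f := id)) //.
rewrite (sum_sesq_symmetrize A tensor_col b (@swap_colsK m n) (f := id)) //.
rewrite (sum_sesq_symmetrize A tensor_col b (@swap_colsK m n) (f := swap_rows)) //.
by rewrite mulrnAr -mulrnDl -mulrnA pmulrn_lge0.
Qed.
End Forms.

(** * Hermitian matrices *)

Lemma hermsymmxP N (M : 'M[C]_N) :
  reflect (forall k l, M k l = (M l k)^*) (M \is hermsymmx).
Proof.
apply: (iffP (is_hermitianmxP _ _ _)) => [M_herm k l | M_herm].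
  by rewrite {1}M_herm expr0 scale1r !mxE.
by apply/matrixP => k l; rewrite expr0 scale1r !mxE.
Qed.

Lemma hermsymmxD N (M1 M2 : 'M[C]_N) :
  M1 \is hermsymmx -> M2 \is hermsymmx -> M1 + M2 \is hermsymmx.
Proof.
move=> /hermsymmxP h1 /hermsymmxP h2; apply/hermsymmxP => k l.
by rewrite !mxE rmorphD /= -h1 -h2.
Qed.

Lemma hermsymmxN N (M : 'M[C]_N) : M \is hermsymmx -> - M \is hermsymmx.
Proof.
move=> /hermsymmxP h; apply/hermsymmxP => k l.
by rewrite !mxE rmorphN /= -h.
Qed.

Lemma hermsymmx_scalar N (c : C) : c^* = c -> (c%:M : 'M_N) \is hermsymmx.
Proof.
move=> c_real; apply/hermsymmxP => k l.
by rewrite !mxE eq_sym; case: eqP => _; rewrite ?mulr1n ?c_real ?mulr0n ?rmorph0.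
Qed.

Lemma hermsymmx_tens p q (X : 'M[C]_p) (Y : 'M[C]_q) :
  X \is hermsymmx -> Y \is hermsymmx -> tensmx X Y \is hermsymmx.
Proof.
move=> /hermsymmxP hX /hermsymmxP hY; apply/hermsymmxP => k l.
by rewrite !mxE rmorphM /= -hX -hY.
Qed.

Lemma loewner_le_sesq N (X Y : 'M[C]_N) :
  X \is hermsymmx -> Y \is hermsymmx ->
  (forall x, 0 <= sesq (Y - X) x x) -> X <=L Y.
Proof.
move=> hX hY YX_ge0; split; [exact: hX | exact: hY | split; last exact: YX_ge0].
exact: hermsymmxD hY (hermsymmxN hX).
Qed.

Section HermitianPartialTraces.
Context {m n : nat} {A : 'M[C]_(m * n)} (A_herm : A \is hermsymmx).
Let Aconj := hermsymmxP _ A_herm.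

Lemma conj_trace_hermsymmx : (\tr A)^* = \tr A.
Proof. by rewrite /mxtrace rmorph_sum /=; apply: eq_bigr => k _; rewrite -Aconj. Qed.

Lemma hermsymmx_ptrace1 : ptrace1 A \is hermsymmx.
Proof.
apply/hermsymmxP => r s; rewrite !summxE rmorph_sum /=.
by apply: eq_bigr => i _; rewrite !mxE -Aconj.
Qed.

Lemma hermsymmx_ptrace2 : ptrace2 A \is hermsymmx.
Proof.
apply/hermsymmxP => i j; rewrite !mxE rmorph_sum /=.
by apply: eq_bigr => r _; rewrite !mxE -Aconj.
Qed.

Lemma hermsymmx_tilde : tildemx A \is hermsymmx.
Proof. by apply/hermsymmxP => k l; rewrite !mxE -Aconj. Qed.
End HermitianPartialTraces.
End ComplexMatrices.

(** * The inequalities *)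

Theorem theorem2p5 (R : realType) (m n : nat) (hm : (1 <= m)%N) (hn : (1 <= n)%N)
    (A : 'M[R[i]]_(m * n)) (hA : psdmx A) :
  [/\ tensmx 1%:M (ptrace2 A) - tildemx A
        <=L (\tr A)%:M - tensmx (ptrace1 A) 1%:M,
      - (tensmx 1%:M (ptrace2 A) - tildemx A)
        <=L (\tr A)%:M - tensmx (ptrace1 A) 1%:M
    & tensmx 1%:M (ptrace2 A) + tildemx A
        <=L (\tr A)%:M + tensmx (ptrace1 A) 1%:M].
Proof.
have [A_herm _] := hA.
have hT := hermsymmx_scalar (n * m) (conj_trace_hermsymmx A_herm).
have h1 p : ((1%:M : 'M[R[i]]_p) \is hermsymmx).
  by apply: hermsymmx_scalar; rewrite rmorph1.
have hP1 := hermsymmx_tens (hermsymmx_ptrace1 A_herm) (h1 m).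
have hP2 := hermsymmx_tens (h1 n) (hermsymmx_ptrace2 A_herm).
have hW := hermsymmx_tilde A_herm.
have form_ge0 a b x := sesq_signed_ptraces_ge0 x a b hA.
have hRB := hermsymmxD hT (hermsymmxN hP1).
have hLB := hermsymmxD hP2 (hermsymmxN hW).
split; [apply: loewner_le_sesq hLB hRB _ | apply: loewner_le_sesq (hermsymmxN hLB) hRB _
  | apply: loewner_le_sesq (hermsymmxD hP2 hW) (hermsymmxD hT hP1) _] => x.
- by have := form_ge0 true true x; rewrite expr1 !scaleN1r.
- by have := form_ge0 false true x; rewrite expr0 expr1 scale1r !scaleN1r opprK.
- by have := form_ge0 true false x; rewrite expr0 expr1 !scale1r scaleN1r.
Qed.
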